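(* Let $G_1$ and $G_2$ be finite groups containing central subgroups $H_1$ and $H_2$ of prime order $p$, respectively. Let $G$ be the central product of $G_1$ and $G_2$ with respect to $H_1$ and $H_2$. Then $$\begin{aligned}h(G)=\;&p^{|I(G_1:H_1)_{H_1}|\,|I(G_2:H_2)_{H_2}|}\\&\times h(G_1)^{|I(G_2:H_2)_{\{1\}}|}\,h(G_2)^{|I(G_1:H_1)_{\{1\}}|}\\&\times h(G_1/H_1)^{|I(G_2:H_2)_{H_2}|}\,h(G_2/H_2)^{|I(G_1:H_1)_{H_1}|}.\end{aligned}$$ In particular, if all of $h(G_1)$, $h(G_2)$, $h(G_1/H_1)$ and $h(G_2/H_2)$ are integers, then so is $h(G)$.
   Context: For a finite group $G$ with conjugacy classes $K_1,\dots,K_s$ and irreducible complex characters $\chi_1,\dots,\chi_s$, Harada's number is $h(G)=\frac{|K_1|\cdots|K_s|}{\chi_1(1)\cdots\chi_s(1)}$. Central product: given finite groups $G_1,G_2$, central subgroups $H_i\le Z(G_i)$ and a group isomorphism $\theta:H_1\to H_2$, the central product of $G_1$ and $G_2$ with respect to $H_1$ and $H_2$ is $G=(G_1\times G_2)/N$ with $N=\{(h_1,\theta(h_1^{-1}))\mid h_1\in H_1\}$. Index sets: for a finite group $G$ with set of conjugacy classes $\mathrm{Conj}(G)$ and a subgroup $Z\le Z(G)$, $Z$ acts on $\mathrm{Conj}(G)$ by $(z,K)\mapsto zK$. Write $\mathrm{Conj}(G/Z)=\{\overline{K}_i\mid i\in I_{G/Z}\}$, choose $g_i\in G$ whose image in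 $G/Z$ lies in $\overline{K}_i$, and let $K_i$ be the conjugacy class of $g_i$ in $G$; then $\{K_i\mid i\in I_{G/Z}\}$ is a complete set of representatives of the $Z$-orbits in $\mathrm{Conj}(G)$. For $K\in\mathrm{Conj}(G)$ let $\mathrm{Ann}_Z(K)=\{z\in Z\mid zK=K\}$, and for $X\le Z$ let $I(G:Z)_X=\{j\in I_{G/Z}\mid\mathrm{Ann}_Z(K_j)=X\}$. In the claim this is applied to the pairs $(G_1,H_1)$ and $(G_2,H_2)$. *)

(* Defs.v *)
From HB Require Import structures.
From mathcomp Require Import all_boot all_order all_algebra all_fingroup.
From mathcomp Require Import all_solvable all_field all_character.

Set Implicit Arguments.
Unset Strict Implicit.
Unset Printing Implicit Defensive.

Import GroupScope Order.TTheory GRing.Theory Num.Theory.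

Definition harada (gT : finGroupType) (G : {group gT}) : algC :=
  ((\prod_(K in classes G) #|K|%:R) / (\prod_(i : Iirr G) 'chi[G]_i 1%g))%R.

Definition cprod_ker (gT1 gT2 : finGroupType) (H1 : {group gT1})
    (theta : {morphism H1 >-> gT2}) : {set gT1 * gT2} :=
  [set (h, theta h^-1) | h in H1].

(* The quotient by a bare set N is, by definition, the quotient by <<N>>;       *)
(* this shows that for abelian H1 no closure is involved.                     *)
Lemma cprod_ker_group_set (gT1 gT2 : finGroupType) (H1 : {group gT1})
    (theta : {morphism H1 >-> gT2}) :
  abelian H1 -> group_set (cprod_ker theta).
Proof.
move=> abH1; apply/group_setP; split=> [|u v].
  by apply/imsetP; exists 1; rewrite ?invg1 ?morph1.
case/imsetP=> x Hx -> /imsetP[y Hy ->]; apply/imsetP; exists (x * y).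
  exact: groupM.
have xy : x * y = y * x by exact: (centsP abH1).
by rewrite [in RHS]xy invMg morphM ?groupV // -xy.
Qed.

Definition ext_central_product (gT1 gT2 : finGroupType)
    (G1 : {group gT1}) (G2 : {group gT2}) (H1 : {group gT1})
    (theta : {morphism H1 >-> gT2}) : {group coset_of (cprod_ker theta)} :=
  (setX G1 G2 / cprod_ker theta)%G.

Definition class_ann (gT : finGroupType) (Z K : {set gT}) : {set gT} :=
  [set z in Z | z *: K == K].

(* A choice of g_i, where the classes of G / Z are indexed by themselves.     *)
Definition class_lift (gT : finGroupType) (G Z : {group gT})
    (g : {set coset_of Z} -> gT) : Prop :=
  forall Kbar, Kbar \in classes (G / Z) ->
    g Kbar \in G /\ coset Z (g Kbar) \in Kbar.

(* I(G : Z)_X, relative to the choice g.                                      *)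
Definition ann_index (gT : finGroupType) (G Z : {group gT})
    (g : {set coset_of Z} -> gT) (X : {set gT}) : {set {set coset_of Z}} :=
  [set Kbar in classes (G / Z) | class_ann Z (g Kbar ^: G) == X].

(* Main.v *)
Require Import Defs.
From HB Require Import structures.
From mathcomp Require Import all_boot all_order all_algebra all_fingroup.
From mathcomp Require Import all_solvable all_field all_character.

Set Implicit Arguments.
Unset Strict Implicit.
Unset Printing Implicit Defensive.

Import GroupScope Order.TTheory GRing.Theory Num.Theory.

(** Put M = G1 x G2 and let N be the kernel of the central product G = M / N.
    For a finite group X let P(X) be the product of its class sizes and D(X)
    the product of its irreducible degrees, so that h(X) = P(X) / D(X). For
    i = 1, 2 let a_i and b_i be the numbers of indices whose annihilator is
    trivial, respectively equal to H_i. The theorem is the quotient of two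
    identities:

      P(G) = p^(b1 b2) P(G1)^a2 P(G2)^a1 P(G1/H1)^b2 P(G2/H2)^b1,
      D(G) =           D(G1)^a2 D(G2)^a1 D(G1/H1)^b2 D(G2/H2)^b1.

    Class sizes. Let Z be central in X. The annihilator A of a class K is its
    stabiliser under translation by Z; the map K -> K / Z is |A|-to-one on
    elements, and |Z : A| classes of X lie above K / Z. Multiplying over all
    classes yields a p-th power identity when |Z| = p
    ([prod_card_class_quotient_prime]): P(X/Z)^p times a power of p is the
    product of the |K|^e with e = |A|, that is, e = p when Z fixes K and e = 1
    otherwise. Applied to (M, N) it only needs the classes of M, which are the
    products K1 x K2, and the remark that N fixes K1 x K2 exactly when H1 fixes
    K1 and H2 fixes K2. Collecting the exponent of each |K1|
    ([prod_card_class_pairs]) and applying the identity once more to (G1, H1),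
    and symmetrically for G2, gives the p-th power of the formula for P(G);
    all quantities being natural numbers, p-th roots may be taken.

    Degrees. Let z generate H1. An irreducible character chi of G1 acts on z by
    the p-th root of unity chi(z) / chi(1). The irreducible characters of M are
    the products of those of G1 and G2, and such a product is trivial on N
    exactly when the two roots of unity, at z and theta(z), agree. So D(G) is
    determined by the number of characters of G2 with given root of unity w.
    There are a2 + b2 of them for w = 1, as these are the characters of G2/H2
    and G2/H2 has a2 + b2 classes. Galois conjugation makes the number the same
    for all w <> 1, and since G2 has p a2 + b2 characters in all, that number
    is a2 ([card_Iirr_over]). *)

(** * Translating conjugacy classes by a central subgroup *)

Section CentralTranslation.

Variables (gT : finGroupType) (G Z : {group gT}).
Hypothesis sZ : Z \subset 'Z(G).

Let nsZG : Z <| G. Proof. exact: sub_center_normal. Qed.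
Let sGN : G \subset 'N(Z). Proof. exact: normal_norm. Qed.
Let sZG : Z \subset G. Proof. exact: normal_sub. Qed.
Let sGCZ : Z \subset 'C(G). Proof. by move: sZ; rewrite subsetI => /andP[]. Qed.

Lemma central_conj z g : z \in Z -> g \in G -> z ^ g = z.
Proof.
by move=> Zz Gg; rewrite conjgE (centP (subsetP sGCZ z Zz) g Gg) mulKg.
Qed.

Lemma class_mul_central z x : z \in Z -> z *: (x ^: G) = (z * x) ^: G.
Proof.
move=> Zz; apply/setP=> y; rewrite mem_lcoset; apply/imsetP/imsetP=> -[g Gg].
  move/(canRL (mulKVg z))->; exists g => //.
  by rewrite conjMg (central_conj Zz Gg).
by move->; exists g; rewrite // conjMg (central_conj Zz Gg) mulKg.
Qed.

Lemma class_ann_lcoset z (K : {set gT}) :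
  z \in Z -> class_ann Z (z *: K) = class_ann Z K.
Proof.
move=> Zz; apply/setP=> y; rewrite !inE; apply: andb_id2l => Zy.
have zy : y * z = z * y.
  exact: esym (centP (subsetP sGCZ z Zz) y (subsetP sZG y Zy)).
by rewrite -lcosetM zy lcosetM (inj_eq (@lcoset_inj _ z)).
Qed.

(** The classes with a given image in the quotient form one orbit under
    translation: if x and y ^ g have the same image, they differ by an element
    of Z, which conjugation does not move. *)
Lemma eq_quotient_classP x y :
    x \in G -> y \in G ->
  reflect (exists2 z, z \in Z & x ^: G = z *: (y ^: G))
          (x ^: G / Z == y ^: G / Z).
Proof.
move=> Gx Gy; apply: (iffP eqP) => [eqKb | [z Zz ->]].
  have Nx : x \in 'N(Z) := subsetP sGN x Gx.
  have: coset Z x \in y ^: G / Z by rewrite -eqKb mem_morphim ?class_refl.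
  case/morphimP=> _ _ /imsetP[g Gg ->] eqx.
  have Nyg : y ^ g \in 'N(Z) by rewrite (subsetP sGN) ?groupJ.
  have /(rcoset_kercosetP Nx Nyg)/rcosetP[z Zz ->] := eqx.
  exists z => //; rewrite class_mul_central //; apply/class_eqP.
  by apply/imsetP; exists g; rewrite // conjMg (central_conj Zz Gg).
have Gz := subsetP sZG z Zz.
rewrite class_mul_central // !quotient_class ?(subsetP sGN) ?groupM //.
by rewrite coset_kerl.
Qed.

Definition class_fiber (Kb : {set coset_of Z}) : {set {set gT}} :=
  [set K in classes G | K / Z == Kb].

Lemma lcoset_rcoset_central z (K : {set gT}) :
  z \in Z -> K \subset G -> z *: K = rcoset K z.
Proof.
move=> Zz sKG; rewrite rcosetE; apply/esym/centC; rewrite centsC sub1set.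
exact: subsetP (subset_trans sGCZ (centS sKG)) z Zz.
Qed.

Lemma class_fiber_orbit x :
  x \in G -> class_fiber (x ^: G / Z) = orbit 'Rs Z (x ^: G).
Proof.
move=> Gx; have sxG : x ^: G \subset G by rewrite class_subG.
apply/setP=> K; rewrite inE; apply/andP/orbitP.
  case=> /imsetP[y Gy ->] /eq_quotient_classP[] // z Zz ->; exists z => //=.
  by rewrite -lcoset_rcoset_central.
case=> z Zz <-; rewrite /= -lcoset_rcoset_central // class_mul_central //.
have Gzx : z * x \in G by rewrite groupM // (subsetP sZG).
split; first exact: mem_classes.
by apply/eq_quotient_classP=> //; exists z => //; rewrite class_mul_central.
Qed.

Lemma class_ann_astab (K : {set gT}) :
  K \subset G -> class_ann Z K = 'C_Z[K | 'Rs].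
Proof.
move=> sKG; apply/setP=> z; rewrite !inE; case: (boolP (z \in Z)) => //= Zz.
by rewrite sub1set inE /= -lcoset_rcoset_central.
Qed.

(** Orbit-stabiliser. As the ambient action on subsets is by right
    translation, left translation is first turned into right translation. *)
Lemma card_class_fiber_ann K :
  K \in classes G -> (#|class_fiber (K / Z)| * #|class_ann Z K|)%N = #|Z|.
Proof.
case/imsetP=> x Gx ->.
rewrite class_fiber_orbit // class_ann_astab ?class_subG //.
exact: card_orbit_stab.
Qed.

Lemma card_class_ann_dvd K : K \in classes G -> #|class_ann Z K| %| #|Z|.
Proof. by move=> KG; rewrite -(card_class_fiber_ann KG) dvdn_mull. Qed.

Lemma class_fiberP x K : x \in G -> K \in class_fiber (x ^: G / Z) ->
  exists2 z, z \in Z & K = z *: (x ^: G).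
Proof.
move=> Gx; rewrite inE => /andP[/imsetP[y Gy ->]].
by case/eq_quotient_classP=> // z Zz ->; exists z.
Qed.

Lemma class_ann_fiber K L :
    K \in classes G -> L \in class_fiber (K / Z) ->
  class_ann Z L = class_ann Z K.
Proof.
by case/imsetP=> x Gx -> /class_fiberP[] // z Zz ->; rewrite class_ann_lcoset.
Qed.

(** The elements of K with the same image as y in K are the z * y with z in the
    annihilator of K: if z * y lies in K = y ^: G then z *: K meets K, hence
    equals it. So each element of K / Z has as many preimages in K as the
    annihilator has elements. *)
Lemma card_class_quotient K :
  K \in classes G -> (#|K / Z| * #|class_ann Z K|)%N = #|K|.
Proof.
move=> KG.
have sKG : K \subset G by case/imsetP: KG => x Gx ->; rewrite class_subG.
have sKN := subset_trans sKG sGN.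
rewrite -[RHS]sum1_card (partition_big_imset (coset Z)) -morphimEsub //=.
rewrite -sum_nat_const; apply: eq_bigr => _ /morphimP[y Ny Ky ->].
rewrite sum1dep_card -[LHS](card_imset _ (mulIg y)); apply: eq_card => k.
have Gy := subsetP sKG y Ky.
have defK : K = y ^: G.
  by case/imsetP: KG Ky => x Gx -> /class_eqP->.
rewrite [RHS]inE; apply/imsetP/andP=> [[z] | [Kk]].
  rewrite inE => /andP[Zz /eqP annz] ->; split; last by rewrite coset_kerl.
  by rewrite -annz mem_lcoset mulKg.
move/eqP/(rcoset_kercosetP (subsetP sKN k Kk) Ny)/rcosetP=> [z Zz def_k].
exists z => //; rewrite inE Zz /= defK class_mul_central // -def_k.
by apply/eqP/class_eqP; rewrite -defK.
Qed.

(** Each class of the quotient has #|Z : A| classes above it, so giving each of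
    these the exponent #|A| counts it #|Z| times. These exponents make
    the product over G computable without choosing lifts. *)
Lemma prod_card_class_quotient :
  ((\prod_(Kb in classes (G / Z)) #|Kb|) ^ #|Z|
   * \prod_(K in classes G) #|class_ann Z K| ^ #|class_ann Z K|
   = \prod_(K in classes G) #|K| ^ #|class_ann Z K|)%N.
Proof.
have ->: ((\prod_(Kb in classes (G / Z)) #|Kb|) ^ #|Z|
          = \prod_(K in classes G) #|K / Z| ^ #|class_ann Z K|)%N.
  rewrite (partition_big_imset (fun K : {set gT} => K / Z)) classes_quotient //.
  rewrite (big_morph (fun n => n ^ #|Z|)%N (fun a b => expnMn a b _) (exp1n _)).
  apply: eq_bigr => _ /imsetP[K KG ->].
  rewrite (eq_bigr (fun=> #|K / Z| ^ #|class_ann Z K|)%N).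
    rewrite prod_nat_const -expnM -(card_class_fiber_ann KG) mulnC.
    congr (_ ^ (_ * _))%N.
    by apply: eq_card => L; rewrite !inE.
  move=> L /andP[LG /eqP eqLK].
  by rewrite eqLK (class_ann_fiber KG) // inE LG eqLK eqxx.
rewrite -big_split /=; apply: eq_bigr => K KG.
by rewrite -expnMn card_class_quotient.
Qed.

(** All classes above an index have the same annihilator, whichever
    representative is chosen; if it is X, there are #|Z : X| of them. *)
Lemma card_class_ann_index (g : {set coset_of Z} -> gT) (X : {set gT}) :
    class_lift G g ->
  (#|X| * #|[set K in classes G | class_ann Z K == X]|
   = #|Z| * #|ann_index G g X|)%N.
Proof.
move=> lift_g.
have annE K : K \in classes G -> class_ann Z (g (K / Z) ^: G) = class_ann Z K.
  move=> KG; have KbG : K / Z \in classes (G / Z).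
    by rewrite classes_quotient // imset_f.
  have [Gg gK] := lift_g _ KbG; apply: (class_ann_fiber KG).
  rewrite inE mem_classes //= quotient_class ?(subsetP sGN) //.
  case/imsetP: KbG gK => xb _ -> gK; exact/eqP/class_eqP.
rewrite mulnC -sum_nat_const.
rewrite (partition_big (fun K : {set gT} => K / Z) [in ann_index G g X]) /=;
  last first.
  move=> K; rewrite !inE => /andP[KG /eqP <-].
  by rewrite classes_quotient // imset_f //= annE.
rewrite mulnC -sum_nat_const; apply: eq_bigr => Kb.
rewrite inE classes_quotient // => /andP[/imsetP[K KG ->]].
rewrite annE // => /eqP annK.
rewrite -(card_class_fiber_ann KG) annK -sum_nat_const; apply: eq_bigl => L.
rewrite !inE andbAC; apply: andb_idr => Lfib.
by rewrite (class_ann_fiber KG) ?annK // inE.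
Qed.

End CentralTranslation.

(** * Central subgroups of prime order *)

Definition fixed_classes (gT : finGroupType) (G Z : {set gT}) :
    {set {set gT}} :=
  [set K in classes G | class_ann Z K == Z].

Definition class_card_prod (gT : finGroupType) (G : {set gT}) : nat :=
  \prod_(K in classes G) #|K|.

Section PrimeCentral.

Variables (gT : finGroupType) (G Z : {group gT}) (p : nat).
Hypotheses (p_pr : prime p) (sZ : Z \subset 'Z(G)) (oZ : #|Z| = p).

Lemma class_ann_sub (K : {set gT}) : class_ann Z K \subset Z.
Proof. by apply/subsetP=> z /setIdP[]. Qed.

Lemma class_ann_full (K : {set gT}) :
  (class_ann Z K == Z) = (#|class_ann Z K| == p).
Proof.
rewrite eqEcard class_ann_sub oZ eqn_leq -{2}oZ.
by rewrite subset_leq_card ?class_ann_sub.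
Qed.

Lemma card_class_ann_prime K : K \in classes G ->
  #|class_ann Z K| = if class_ann Z K == Z then p else 1%N.
Proof.
move=> KG; rewrite class_ann_full; have := card_class_ann_dvd sZ KG.
rewrite oZ; have [-> _ | n1 /prime_nt_dvdP-> //] := eqVneq #|class_ann Z K| 1%N.
  by case: eqP.
by rewrite eqxx.
Qed.

Lemma class_ann_eq1 K :
  K \in classes G -> (class_ann Z K == 1) = (class_ann Z K != Z).
Proof.
move=> KG; have s1A : [1 gT] \subset class_ann Z K.
  by rewrite sub1set inE group1 mul1g eqxx.
rewrite eq_sym eqEcard s1A cards1 card_class_ann_prime //.
by case: eqP => //=; rewrite leqNgt prime_gt1.
Qed.

(** A class fixed by Z is the only class above its image. *)
Lemma card_ann_index_full (g : {set coset_of Z} -> gT) :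
  class_lift G g -> #|ann_index G g Z| = #|fixed_classes G Z|.
Proof.
move/(card_class_ann_index sZ Z)/eqP; rewrite eqn_pmul2l ?cardG_gt0 //.
by move/eqP.
Qed.

(** A class with trivial annihilator lies in an orbit of p such classes. *)
Lemma card_classes_ann_index (g : {set coset_of Z} -> gT) :
  class_lift G g ->
  #|classes G| = (p * #|ann_index G g [1 gT]| + #|fixed_classes G Z|)%N.
Proof.
move=> lift_g.
rewrite -oZ -(card_class_ann_index sZ [1 gT] lift_g) cards1 mul1n.
rewrite -[LHS](cardsID (fixed_classes G Z)) addnC.
congr (_ + _)%N; apply: eq_card => K.
  rewrite !inE; case: (boolP (K \in classes G)) => //= KG.
  by rewrite class_ann_eq1 // andbT.
by rewrite !inE; case: (K \in classes G).
Qed.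

Lemma card_classes_quotient_prime (g : {set coset_of Z} -> gT) :
  class_lift G g ->
  #|classes (G / Z)| = (#|ann_index G g [1 gT]| + #|ann_index G g Z|)%N.
Proof.
move=> lift_g; rewrite -[LHS](cardsID (ann_index G g Z)) addnC.
congr (_ + _)%N; apply: eq_card => Kb.
  rewrite !inE; case: (boolP (Kb \in _)) => //= KbG.
  by have [Gg _] := lift_g Kb KbG; rewrite class_ann_eq1 ?mem_classes // andbT.
by rewrite !inE; case: (Kb \in _).
Qed.

(** The exponent is the order of the annihilator, written as a conditional so
    that annihilators in a direct product can be compared with those in the
    factors. *)
Lemma prod_card_class_quotient_prime :
  (\prod_(K in classes G) #|K| ^ (if class_ann Z K == Z then p else 1)
   = (class_card_prod (G / Z) * p ^ #|fixed_classes G Z|) ^ p)%N.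
Proof.
have eqA := @card_class_ann_prime.
under eq_bigr => K KG do rewrite -eqA //.
rewrite -(prod_card_class_quotient sZ) oZ expnMn; congr (_ * _)%N.
under eq_bigr => K KG do rewrite eqA //.
rewrite -expnM mulnC expnM -prod_nat_const.
rewrite [RHS](eq_bigl (fun K => (K \in classes G) && (class_ann Z K == Z)));
  last by move=> K; rewrite inE.
by rewrite big_mkcondr; apply: eq_bigr => K _; case: ifP.
Qed.

End PrimeCentral.

(** * The product of the class sizes of a central product *)

Section ClassPairs.

Variables (gT1 gT2 : finGroupType) (p : nat).
Variables (G1 Z1 : {group gT1}) (G2 Z2 : {group gT2}).
Hypotheses (p_pr : prime p) (sZ1 : Z1 \subset 'Z(G1)) (oZ1 : #|Z1| = p).
Hypotheses (sZ2 : Z2 \subset 'Z(G2)) (oZ2 : #|Z2| = p).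
Variable (g2 : {set coset_of Z2} -> gT2).
Hypothesis lift_g2 : class_lift G2 g2.

(** For fixed K1, the exponents sum over K2 to p * a2 + b2 * e1, where e1 is
    the order of the annihilator of K1: the p * a2 classes K2 not fixed by Z2
    contribute 1 each and the b2 fixed ones contribute e1 each. The terms
    p * a2 assemble to a power of the product for G1, and the terms b2 * e1 to
    a power of the p-th power identity for (G1, Z1). *)
Lemma prod_card_class_pairs :
  (\prod_(K1 in classes G1) \prod_(K2 in classes G2)
     #|K1| ^ (if (class_ann Z1 K1 == Z1) && (class_ann Z2 K2 == Z2)
              then p else 1)
   = (class_card_prod G1 ^ #|ann_index G2 g2 [1 gT2]|
      * (class_card_prod (G1 / Z1) * p ^ #|fixed_classes G1 Z1|)
          ^ #|fixed_classes G2 Z2|) ^ p)%N.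
Proof.
rewrite expnMn -!expnM [(#|fixed_classes G2 Z2| * p)%N]mulnC !expnM.
rewrite -(prod_card_class_quotient_prime p_pr sZ1 oZ1) -expnM [(_ * p)%N]mulnC.
have mX n := big_morph (fun m => m ^ n)%N (fun a b => expnMn a b n) (exp1n n).
rewrite !mX -big_split /=; apply: eq_bigr => K1 _.
rewrite -expnM -expnD -expn_sum; congr (_ ^ _)%N.
rewrite (bigID [in fixed_classes G2 Z2]) /= addnC; congr (_ + _)%N.
  rewrite (eq_bigr (fun=> 1%N)) => [|K2]; last first.
    by rewrite inE => /andP[-> /= /negPf->]; rewrite andbF.
  rewrite sum1_card; apply/eqP; rewrite -(eqn_add2r #|fixed_classes G2 Z2|).
  rewrite -(card_classes_ann_index p_pr sZ2 oZ2 lift_g2); apply/eqP.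
  rewrite -[RHS](cardsID (fixed_classes G2 Z2)) addnC.
  congr (_ + _)%N; apply: eq_card => K.
    by rewrite !inE; case: (K \in classes G2).
  by rewrite unfold_in !inE andbC.
rewrite (eq_bigr (fun=> if class_ann Z1 K1 == Z1 then p else 1%N)) => [|K2];
  last by rewrite !inE => /and3P[_ _ ->]; rewrite andbT.
rewrite sum_nat_const mulnC; congr (_ * _)%N; apply: eq_card => K.
by rewrite unfold_in !inE andbA andbb.
Qed.

End ClassPairs.

Section ClassesSetX.

Variables (gT1 gT2 : finGroupType) (G1 : {group gT1}) (G2 : {group gT2}).

Lemma class_setX x y : (x, y) ^: setX G1 G2 = setX (x ^: G1) (y ^: G2).
Proof.
apply/setP=> -[a b]; rewrite in_setX /=; apply/imsetP/andP=> [[[g h]]|].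
  rewrite in_setX /= => /andP[Gg Gh] [-> ->].
  by split; apply/imsetP; [exists g | exists h].
case=> /imsetP[g Gg ->] /imsetP[h Gh ->].
by exists (g, h); rewrite // in_setX Gg.
Qed.

Lemma setX_inj_classes :
  {in setX (classes G1) (classes G2) &, injective (fun u => setX u.1 u.2)}.
Proof.
case=> [K1 K2] [L1 L2]; rewrite !in_setX /=.
case/andP=> /imsetP[x Gx ->] /imsetP[y Gy ->].
case/andP=> /imsetP[x' Gx' ->] /imsetP[y' Gy' ->] eqX.
have: (x, y) \in setX (x' ^: G1) (y' ^: G2) by rewrite -eqX in_setX !class_refl.
by rewrite in_setX /= => /andP[/class_eqP-> /class_eqP->].
Qed.

Lemma classes_setX :
  classes (setX G1 G2)
    = [set setX u.1 u.2 | u in setX (classes G1) (classes G2)].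
Proof.
apply/setP=> K; apply/imsetP/imsetP=> [[[x y]] | [[K1 K2]]]; rewrite in_setX /=.
  case/andP=> Gx Gy ->; exists (x ^: G1, y ^: G2); last exact: class_setX.
  by rewrite in_setX !mem_classes.
case/andP=> /imsetP[x Gx ->] /imsetP[y Gy ->] ->.
by exists (x, y); rewrite ?class_setX // in_setX Gx.
Qed.

Lemma card_classes_setX :
  #|classes (setX G1 G2)| = (#|classes G1| * #|classes G2|)%N.
Proof.
by rewrite classes_setX card_in_imset ?cardsX //; apply: setX_inj_classes.
Qed.

Lemma big_classes_setX (F : {set gT1 * gT2} -> nat) :
  (\prod_(K in classes (setX G1 G2)) F K
   = \prod_(K1 in classes G1) \prod_(K2 in classes G2) F (setX K1 K2))%N.
Proof.
rewrite classes_setX big_imset /=; last exact: setX_inj_classes.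
by rewrite pair_big; apply: eq_bigl => u; rewrite inE.
Qed.

End ClassesSetX.

(** Extraction of p-th roots: P1, P2, Q1, Q2 stand for the products of class
    sizes of the two factors and their quotients, R for that of the central
    product. Of the two powers p ^ (b1 * b2) on the left, only one is matched on
    the right; the other one is the power of p in the theorem. *)
Lemma cancel_roots p P1 P2 Q1 Q2 R a1 a2 b1 b2 : (0 < p ->
    (P1 ^ a2 * (Q1 * p ^ b1) ^ b2 * (P2 ^ a1 * (Q2 * p ^ b2) ^ b1)) ^ p
      = (R * p ^ (b1 * b2)) ^ p ->
  R = p ^ (b1 * b2) * (P1 ^ a2 * P2 ^ a1) * (Q1 ^ b2 * Q2 ^ b1))%N.
Proof.
move=> p_gt0 /(expIn p_gt0) eqR; apply/eqP.
rewrite -(eqn_pmul2r (_ : 0 < p ^ (b1 * b2)))%N ?expn_gt0 ?p_gt0 //.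
rewrite -eqR; apply/eqP.
rewrite !expnMn -!expnM [(b2 * b1)%N]mulnC.
by rewrite (muln.[AC ((1*2)*(1*2)) (3*(1*4)*(2*5)*6)]).
Qed.

Section CentralProduct.

Variables (gT1 gT2 : finGroupType) (G1 H1 : {group gT1}) (G2 H2 : {group gT2}).
Variables (p : nat) (theta : {morphism H1 >-> gT2}).
Hypotheses (p_pr : prime p) (sH1 : H1 \subset 'Z(G1)) (sH2 : H2 \subset 'Z(G2)).
Hypotheses (oH1 : #|H1| = p) (oH2 : #|H2| = p) (iso : isom H1 H2 theta).

Let abH1 : abelian H1.
Proof. exact: abelianS sH1 (center_abelian _). Qed.

Let N := Group (cprod_ker_group_set theta abH1).

Lemma cprod_ker_central : N \subset 'Z(setX G1 G2).
Proof.
have imH : {in H1, forall h, theta h \in 'Z(G2)}.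
  move=> h Hh; apply: (subsetP sH2).
  by case/isomP: iso => _ <-; apply: mem_morphim.
apply/subsetP=> _ /imsetP[h Hh ->].
have /centerP[G1h ch] := subsetP sH1 h Hh.
have /centerP[G2h ch'] := imH _ (groupVr Hh).
apply/centerP; split; first by rewrite in_setX G1h.
case=> x y; rewrite in_setX => /andP[/= Gx Gy].
by congr (_, _); [apply: ch | apply: ch'].
Qed.

Lemma card_cprod_ker : #|N| = p.
Proof. by rewrite -oH1; apply: card_imset => h k [->]. Qed.

(** Translation by (h, theta h^-1) acts on both factors separately, and when h
    runs through H1, theta h^-1 runs through H2. *)
Lemma class_ann_cprod_ker K1 K2 : K1 \in classes G1 -> K2 \in classes G2 ->
  (class_ann N (setX K1 K2) == N)
    = (class_ann H1 K1 == H1) && (class_ann H2 K2 == H2).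
Proof.
move=> K1G K2G.
have fixE (gT : finGroupType) (Z K : {set gT}) :
    reflect {in Z, forall z, z *: K = K} (class_ann Z K == Z).
  apply: (iffP eqP) => [defZ z|fixK].
    by rewrite -{1}defZ inE => /andP[_ /eqP].
  by apply/setP=> z; rewrite inE; apply: andb_idr => /fixK->.
have lcX a b : (a, b) *: setX K1 K2 = setX (a *: K1) (b *: K2).
  by apply/setP=> -[x y]; rewrite !(mem_lcoset, in_setX) /= -!mem_lcoset.
have [x1 K1x] : exists x, x \in K1.
  by case/imsetP: K1G => x _ ->; exists x; apply: class_refl.
have [x2 K2x] : exists x, x \in K2.
  by case/imsetP: K2G => x _ ->; exists x; apply: class_refl.
have eqX (L1 : {set gT1}) (L2 : {set gT2}) :
    setX L1 L2 = setX K1 K2 -> L1 = K1 /\ L2 = K2.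
  move/setP=> eqL; have: (x1, x2) \in setX L1 L2 by rewrite eqL in_setX K1x.
  rewrite in_setX /= => /andP[Lx1 Lx2].
  split; apply/setP=> y.
    by have:= eqL (y, x2); rewrite !in_setX /= K2x Lx2 !andbT.
  by have:= eqL (x1, y); rewrite !in_setX /= K1x Lx1.
apply/fixE/andP=> [fixN | [/fixE fix1 /fixE fix2]].
  have fixh h : h \in H1 -> h *: K1 = K1 /\ theta h^-1 *: K2 = K2.
    by move=> Hh; apply: eqX; rewrite -lcX; apply: fixN; apply: imset_f.
  split; apply/fixE; first by move=> h /fixh[].
  case/isomP: iso => _ <- _ /morphimP[h _ Hh ->].
  by rewrite -[h]invgK; case: (fixh h^-1 (groupVr Hh)).
move=> _ /imsetP[h Hh ->]; rewrite lcX fix1 // fix2 //.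
by case/isomP: iso => _ <-; rewrite mem_morphim ?groupV.
Qed.

Variables (g1 : {set coset_of H1} -> gT1) (g2 : {set coset_of H2} -> gT2).
Hypotheses (lift_g1 : class_lift G1 g1) (lift_g2 : class_lift G2 g2).

Lemma card_fixed_classes_setX :
  #|fixed_classes (setX G1 G2) N|
    = (#|fixed_classes G1 H1| * #|fixed_classes G2 H2|)%N.
Proof.
set F := setX (fixed_classes G1 H1) (fixed_classes G2 H2).
rewrite -cardsX -(card_in_imset (D := F) (f := fun u => setX u.1 u.2));
  last first.
  apply: (sub_in2 _ (@setX_inj_classes _ _ G1 G2)) => u.
  by rewrite !inE => /andP[/andP[-> _] /andP[-> _]].
apply: eq_card => K; rewrite inE classes_setX; apply/andP/imsetP.
  case=> /imsetP[[K1 K2]]; rewrite in_setX /= => /andP[K1G K2G] ->.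
  rewrite class_ann_cprod_ker // => /andP[f1 f2].
  by exists (K1, K2); rewrite // !inE K1G K2G f1.
case=> -[K1 K2]; rewrite !inE /= => /andP[/andP[K1G f1] /andP[K2G f2]] ->.
split.
  by apply/imsetP; exists (K1, K2); rewrite // in_setX K1G.
by rewrite class_ann_cprod_ker ?f1.
Qed.

(** In the p-th power identity for (G1 x G2, N), splitting #|K1 x K2| into
    #|K1| * #|K2| leaves two products of the shape treated above, one for each
    order of the two factors. *)
Lemma class_card_prod_central_product :
  (class_card_prod (setX G1 G2 / N)
   = p ^ (#|ann_index G1 g1 H1| * #|ann_index G2 g2 H2|)
     * (class_card_prod G1 ^ #|ann_index G2 g2 [1 gT2]|
        * class_card_prod G2 ^ #|ann_index G1 g1 [1 gT1]|)
     * (class_card_prod (G1 / H1) ^ #|ann_index G2 g2 H2|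
        * class_card_prod (G2 / H2) ^ #|ann_index G1 g1 H1|))%N.
Proof.
have p_gt0 := prime_gt0 p_pr.
have := prod_card_class_quotient_prime p_pr cprod_ker_central card_cprod_ker.
rewrite big_classes_setX.
under eq_bigr => K1 K1G do under eq_bigr => K2 K2G do
  rewrite class_ann_cprod_ker // cardsX expnMn.
under eq_bigr => K1 _ do rewrite big_split /=.
rewrite big_split /= (prod_card_class_pairs p_pr sH1 oH1 sH2 oH2 lift_g2).
rewrite exchange_big /=.
under eq_bigr => K2 _ do under eq_bigr => K1 _ do rewrite andbC.
rewrite (prod_card_class_pairs p_pr sH2 oH2 sH1 oH1 lift_g1) -expnMn.
rewrite card_fixed_classes_setX (card_ann_index_full sH1 lift_g1).
rewrite (card_ann_index_full sH2 lift_g2).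
exact: cancel_roots.
Qed.

End CentralProduct.

(** * Irreducible characters above a given central character *)

Section CentralValue.

Local Open Scope ring_scope.
Local Open Scope group_scope.

Variables (gT : finGroupType) (G : {group gT}).
Implicit Types (i : Iirr G) (z : gT).

(** The scalar by which a central element z acts in a representation affording
    'chi_i. *)
Definition central_value i z : algC := ('chi_i z / 'chi_i 1%g)%R.

Lemma central_value_lin i : exists2 xi : 'CF('Z(G)), xi \is a linear_char &
  {in 'Z(G), central_value i =1 xi}.
Proof.
have sZ : 'Z(G) \subset 'Z('chi_i)%CF by rewrite -cap_cfcenter_irr bigcap_inf.
have [xi lin_xi defRes] := cfcenter_Res 'chi_i.
exists ('Res['Z(G)] xi); first exact: cfRes_lin_char.
move=> z Zz; have Zcz := subsetP sZ z Zz.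
rewrite cfResE // /central_value -(cfResE _ (cfcenter_sub _) Zcz) defRes cfunE.
by rewrite mulrAC divff ?mul1r ?irr1_neq0.
Qed.

Lemma central_valueX i z n : z \in 'Z(G) ->
  central_value i (z ^+ n) = (central_value i z ^+ n)%R.
Proof.
have [xi lin_xi cvE] := central_value_lin i => Zz.
by rewrite !cvE ?groupX ?lin_charX.
Qed.

Lemma central_value1 i : central_value i 1 = 1%R.
Proof. by rewrite /central_value divff ?irr1_neq0. Qed.

Lemma central_valueV i z : z \in 'Z(G) ->
  central_value i z^-1 = (central_value i z)^-1%R.
Proof.
have [xi lin_xi cvE] := central_value_lin i => Zz.
by rewrite !cvE ?groupV ?lin_charV.
Qed.

Lemma central_value_neq0 i z : z \in 'Z(G) -> central_value i z != 0%R.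
Proof.
have [xi lin_xi cvE] := central_value_lin i => Zz.
by rewrite cvE ?lin_char_neq0.
Qed.

Lemma mem_cfker_central i z :
  (z \in cfker 'chi_i) = (central_value i z == 1%R).
Proof.
rewrite cfkerEirr inE -[RHS](inj_eq (mulIf (irr1_neq0 i))).
by rewrite divfK ?irr1_neq0 // mul1r.
Qed.

Lemma central_value_aut (u : {rmorphism algC -> algC}) i z :
  central_value (aut_Iirr u i) z = u (central_value i z).
Proof. by rewrite /central_value aut_IirrE !cfunE fmorph_div. Qed.

Definition Iirr_over z w : {set Iirr G} := [set i | central_value i z == w].

End CentralValue.

Lemma prime_unity_root_prim (p : nat) (w : algC) :
  prime p -> (w ^+ p = 1)%R -> w != 1%R -> (p.-primitive_root w)%R.
Proof.
move=> p_pr wp1 w_neq1.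
have [m prim_m m_dv_p] := prim_order_exists (prime_gt0 p_pr) wp1.
have m_neq1 : m != 1%N.
  by apply: contraNneq w_neq1 => m1; rewrite -(prim_expr_order prim_m) m1 expr1.
by move: prim_m; rewrite ((prime_nt_dvdP p_pr m_neq1) m_dv_p).
Qed.

Section PrimeCenter.

Local Open Scope ring_scope.
Local Open Scope group_scope.

Variables (gT : finGroupType) (G : {group gT}) (z : gT) (p : nat).
Hypotheses (p_pr : prime p) (Zz : z \in 'Z(G)) (oz : #[z] = p).

Lemma central_value_unity (i : Iirr G) : (central_value i z ^+ p = 1)%R.
Proof. by rewrite -central_valueX // -oz expg_order central_value1. Qed.

(** Writing v as a power of w with exponent prime to p, a Galois
    automorphism raising p-th roots of unity to that power permutes the
    irreducible characters and carries those with value w to characters with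
    value v. Exchanging w and v gives equality. *)
Lemma leq_card_Iirr_over (w v : algC) :
    (w ^+ p = 1)%R -> w != 1%R -> (v ^+ p = 1)%R -> v != 1%R ->
  (#|Iirr_over G z w| <= #|Iirr_over G z v|)%N.
Proof.
move=> wp1 w1 vp1 v1; have prim_w := prime_unity_root_prim p_pr wp1 w1.
have [[k ltkp] /= def_v] := prim_rootP prim_w vp1.
have co_kp : coprime k p.
  rewrite coprime_sym prime_coprime // gtnNdvd // lt0n.
  by apply: contraNneq v1 => k0; rewrite def_v k0.
have [u uE] := Qn_aut_exists co_kp.
rewrite -(card_imset _ (@aut_Iirr_inj _ G u)); apply/subset_leq_card/subsetP.
move=> _ /imsetP[i] /[!inE] /eqP cvi ->.
by rewrite central_value_aut cvi uE // -def_v.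
Qed.

Lemma card_Iirr_over_nontriv (w : algC) : (w ^+ p = 1)%R -> w != 1%R ->
  #|classes G| = (#|Iirr_over G z 1%R| + p.-1 * #|Iirr_over G z w|)%N.
Proof.
move=> wp1 w1; have prim_w := prime_unity_root_prim p_pr wp1 w1.
rewrite -NirrE -[LHS]card_ord -[LHS]sum1_card.
(* Sort the characters by the exponent k of their central value w ^ k. *)
rewrite (partition_big
  (fun i => sval (prim_rootP prim_w (central_value_unity i))) predT) //=.
have p_gt0 := prime_gt0 p_pr.
rewrite (eq_bigr (fun k : 'I_p => #|Iirr_over G z (w ^+ k)%R|)) => [|k _];
  last first.
  rewrite sum1dep_card; apply: eq_card => i; rewrite !inE.
  case: prim_rootP => j /= ->.
  by rewrite (eq_prim_root_expr prim_w) !modn_small ?ltn_ord.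
rewrite (bigD1 (Ordinal p_gt0)) //= expr0; congr (_ + _)%N.
rewrite (eq_bigr (fun=> #|Iirr_over G z w|)) => [|k k0]; last first.
  have wk1 : (w ^+ k != 1)%R.
    by rewrite -(prim_order_dvd prim_w) gtnNdvd // lt0n.
  have wkp : ((w ^+ k) ^+ p = 1)%R by rewrite exprAC wp1 expr1n.
  by apply/eqP; rewrite eqn_leq !leq_card_Iirr_over.
rewrite sum_nat_const; congr (_ * _)%N.
by rewrite cardC1 card_ord.
Qed.

Variable Z : {group gT}.
Hypotheses (genZ : <[z]> = Z) (sZ : Z \subset 'Z(G)).

Lemma central_subgroup_cfker (i : Iirr G) :
  (Z \subset cfker 'chi_i) = (i \in Iirr_over G z 1%R).
Proof. by rewrite -genZ cycle_subG mem_cfker_central inE. Qed.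

Lemma prod_Iirr_quotient (F : Iirr G -> algC) :
  (\prod_(i in Iirr_over G z 1%R) F i
   = \prod_(i : Iirr (G / Z)) F (mod_Iirr i))%R.
Proof.
have nsZG : Z <| G by apply: sub_center_normal.
under eq_bigl => i do rewrite -central_subgroup_cfker.
rewrite (reindex _ (mod_Iirr_bij nsZG)) /=; apply: eq_bigl => i.
by rewrite mod_IirrE ?cfker_mod.
Qed.

Lemma card_Iirr_over1 : #|Iirr_over G z 1%R| = #|classes (G / Z)|.
Proof.
have nsZG : Z <| G by apply: sub_center_normal.
rewrite -NirrE -[RHS]card_ord -(card_imset _ (can_inj (mod_IirrK nsZG))).
apply: eq_card => i; rewrite -central_subgroup_cfker.
apply/idP/imsetP => [kerZ | [j _ ->]].
  by exists (quo_Iirr Z i); rewrite ?quo_IirrK.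
by rewrite mod_IirrE ?cfker_mod.
Qed.

Variable g : {set coset_of Z} -> gT.
Hypothesis lift_g : class_lift G g.

(** Counting characters as classes: G has p * a + b classes and G / Z has
    a + b, so the p - 1 equal counts for nontrivial roots of unity add up to
    (p - 1) * a. *)
Lemma card_Iirr_over (w : algC) : (w ^+ p = 1)%R ->
  #|Iirr_over G z w|
    = (#|ann_index G g [1 gT]| + (w == 1%R) * #|ann_index G g Z|)%N.
Proof.
have oZ : #|Z| = p by rewrite -genZ.
move=> wp1; have Q1 := card_classes_quotient_prime p_pr sZ oZ lift_g.
have [-> | w1] := eqVneq w 1%R; first by rewrite card_Iirr_over1 mul1n.
have := card_Iirr_over_nontriv wp1 w1; rewrite card_Iirr_over1 Q1.
rewrite (card_classes_ann_index p_pr sZ oZ lift_g).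
rewrite -(card_ann_index_full sZ lift_g).
rewrite mul0n addn0 addnAC => /addIn.
rewrite -{1}(prednK (prime_gt0 p_pr)) mulSn => /addnI/eqP.
by rewrite eqn_pmul2l -?subn1 ?subn_gt0 ?prime_gt1 // => /eqP.
Qed.

End PrimeCenter.

(** * The product of the irreducible degrees of a central product *)

Definition irr_degree_prod (gT : finGroupType) (G : {group gT}) : algC :=
  (\prod_(i : Iirr G) 'chi_i 1%g)%R.

Lemma haradaE (gT : finGroupType) (G : {group gT}) :
  harada G = ((class_card_prod G)%:R / irr_degree_prod G)%R.
Proof. by rewrite /harada /class_card_prod natr_prod. Qed.

Section IirrSetX.

Local Open Scope ring_scope.
Local Open Scope group_scope.

Variables (gT1 gT2 : finGroupType) (G1 : {group gT1}) (G2 : {group gT2}).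

Lemma isom_pairg1 :
  isom G1 (setX G1 [1 gT2]) (restrm (subsetT G1) (@pairg1 gT1 gT2)).
Proof.
apply/isomP; split; first by rewrite injm_restrm ?injm_pairg1.
by rewrite morphim_restrm morphim_pairg1 setIid.
Qed.

Lemma isom_pair1g :
  isom G2 (setX [1 gT1] G2) (restrm (subsetT G2) (@pair1g gT1 gT2)).
Proof.
apply/isomP; split; first by rewrite injm_restrm ?injm_pair1g.
by rewrite morphim_restrm morphim_pair1g setIid.
Qed.

(** The external product of characters: G1 and G2 are carried to their copies in
    gT1 * gT2, of which setX G1 G2 is the internal direct product. *)
Definition setX_Iirr (ij : Iirr G1 * Iirr G2) : Iirr (setX G1 G2) :=
  dprod_Iirr (setX_dprod G1 G2)
    (isom_Iirr isom_pairg1 ij.1, isom_Iirr isom_pair1g ij.2).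

Lemma setX_IirrE i j x y : x \in G1 -> y \in G2 ->
  'chi_(setX_Iirr (i, j)) (x, y) = ('chi_i x * 'chi_j y)%R.
Proof.
move=> Gx Gy; rewrite dprod_IirrE !isom_IirrE.
have -> : (x, y) = @pairg1 gT1 gT2 x * @pair1g gT1 gT2 y.
  by congr (_, _); rewrite ?mulg1 ?mul1g.
rewrite cfDprodE; last 2 first.
- by rewrite in_setX /= Gx inE eqxx.
- by rewrite in_setX /= Gy inE eqxx.
by rewrite (cfIsomE isom_pairg1 _ Gx) (cfIsomE isom_pair1g _ Gy).
Qed.

(** Injectivity suffices, because irreducible characters are as numerous as
    conjugacy classes and those multiply. *)
Lemma setX_Iirr_bij : bijective setX_Iirr.
Proof.
apply: inj_card_bij; last first.
  by rewrite card_prod !card_ord !NirrE card_classes_setX.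
case=> i j [k l] /dprod_Iirr_inj[].
by move=> /isom_Iirr_inj-> /isom_Iirr_inj->.
Qed.

End IirrSetX.

Section CentralProductCharacters.

Local Open Scope ring_scope.
Local Open Scope group_scope.

Variables (gT1 gT2 : finGroupType) (G1 H1 : {group gT1}) (G2 H2 : {group gT2}).
Variable theta : {morphism H1 >-> gT2}.
Hypotheses (sH1 : H1 \subset 'Z(G1)) (sH2 : H2 \subset 'Z(G2)).
Hypothesis iso : isom H1 H2 theta.

(** On (h, theta h^-1) the product character takes its value at 1 times
    the quotient of the central values at h and theta h. Equality of the two
    central values at a generator propagates to all its powers. *)
Lemma cprod_ker_cfker z i j : <[z]> = H1 ->
  (cprod_ker theta \subset cfker 'chi_(@setX_Iirr _ _ G1 G2 (i, j)))
    = (central_value i z == central_value j (theta z)).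
Proof.
move=> genH1.
have Hz : z \in H1 by rewrite -genH1 cycle_id.
have thH h : h \in H1 -> theta h \in H2.
  by move=> Hh; case/isomP: iso => _ <-; rewrite mem_morphim.
have Z2 h : h \in H1 -> theta h \in 'Z(G2) by move/thH/(subsetP sH2).
have Z1 h : h \in H1 -> h \in 'Z(G1) by move/(subsetP sH1).
have kerE h : h \in H1 -> ((h, theta h^-1) \in cfker 'chi_(setX_Iirr (i, j)))
    = (central_value i h == central_value j (theta h)).
  move=> Hh; have [/Z1/centerP[Gh _] /groupVr/Z2/centerP[Gth _]] := (Hh, Hh).
  rewrite cfkerEirr inE setX_IirrE // -[1]/(1 : gT1, 1 : gT2) setX_IirrE //.
  have d_neq0 := mulf_neq0 (irr1_neq0 i) (irr1_neq0 j).
  rewrite -[LHS](inj_eq (mulIf (invr_neq0 d_neq0))).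
  rewrite divff // -mulf_div.
  rewrite -!/(central_value _ _) morphV // central_valueV ?Z2 //.
  have cv_neq0 := central_value_neq0 j (Z2 h Hh).
  rewrite -[RHS](inj_eq (mulIf (invr_neq0 cv_neq0))).
  by rewrite divff.
apply/subsetP/idP => [kerN | /eqP cvz _ /imsetP[h Hh ->]].
  by rewrite -kerE //; apply: kerN; apply: imset_f.
rewrite kerE //; have /cycleP[k ->] : h \in <[z]> by rewrite genH1.
by rewrite morphX // !central_valueX ?Z1 ?Z2 // cvz.
Qed.

End CentralProductCharacters.

Section DegreePairs.

Local Open Scope ring_scope.
Local Open Scope group_scope.

Variables (gT1 gT2 : finGroupType) (G1 Z1 : {group gT1}) (G2 Z2 : {group gT2}).
Variables (p : nat) (z1 : gT1) (z2 : gT2) (g2 : {set coset_of Z2} -> gT2).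
Hypotheses (p_pr : prime p) (sZ1 : Z1 \subset 'Z(G1)) (sZ2 : Z2 \subset 'Z(G2)).
Hypotheses (gen1 : <[z1]> = Z1) (gen2 : <[z2]> = Z2).
Hypotheses (oz1 : #[z1] = p) (oz2 : #[z2] = p).
Hypothesis lift_g2 : class_lift G2 g2.

(** Each degree 'chi_i 1 occurs once for every matching j. That is a2 times, and
    b2 more times when 'chi_i is trivial on Z1, in which case it is a character
    of G1 / Z1. *)
Lemma prod_degree_pairs :
  (\prod_(i : Iirr G1)
     \prod_(j : Iirr G2 | central_value i z1 == central_value j z2) 'chi_i 1%g
   = irr_degree_prod G1 ^+ #|ann_index G2 g2 [1 gT2]|
     * irr_degree_prod (G1 / Z1)%G ^+ #|ann_index G2 g2 Z2|)%R.
Proof.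
have Zz1 : z1 \in 'Z(G1) by rewrite (subsetP sZ1) // -gen1 cycle_id.
have Zz2 : z2 \in 'Z(G2) by rewrite (subsetP sZ2) // -gen2 cycle_id.
have -> : irr_degree_prod (G1 / Z1)%G
          = (\prod_(i in Iirr_over G1 z1 1) 'chi_i 1%g)%R.
  rewrite (prod_Iirr_quotient gen1 sZ1); apply: eq_bigr => i _.
  by rewrite mod_IirrE ?cfMod1 // sub_center_normal.
rewrite -!prodrXl [X in (_ * X)%R]big_mkcond -big_split /=.
apply: eq_bigr => i _.
rewrite prodr_const inE.
rewrite (_ : #|_| = #|Iirr_over G2 z2 (central_value i z1)|); last first.
  by apply: eq_card => j; rewrite inE unfold_in /= eq_sym.
rewrite (card_Iirr_over p_pr Zz2 oz2 gen2 sZ2 lift_g2);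
  last exact: central_value_unity Zz1 oz1 i.
by case: eqP => _; rewrite ?mul1n ?exprD // mul0n addn0 mulr1.
Qed.

End DegreePairs.

(** * Harada's number of a central product *)

Section HaradaCentralProduct.

Local Open Scope ring_scope.
Local Open Scope group_scope.

Variables (gT1 gT2 : finGroupType) (G1 H1 : {group gT1}) (G2 H2 : {group gT2}).
Variables (p : nat) (theta : {morphism H1 >-> gT2}).
Hypotheses (p_pr : prime p) (sH1 : H1 \subset 'Z(G1)) (sH2 : H2 \subset 'Z(G2)).
Hypotheses (oH1 : #|H1| = p) (oH2 : #|H2| = p) (iso : isom H1 H2 theta).
Variables (g1 : {set coset_of H1} -> gT1) (g2 : {set coset_of H2} -> gT2).
Hypotheses (lift_g1 : class_lift G1 g1) (lift_g2 : class_lift G2 g2).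

Lemma irr_degree_prod_central_product :
  irr_degree_prod (ext_central_product G1 G2 theta) =
   ((irr_degree_prod G1 ^+ #|ann_index G2 g2 [1 gT2]|
     * irr_degree_prod G2 ^+ #|ann_index G1 g1 [1 gT1]|)
    * (irr_degree_prod (G1 / H1)%G ^+ #|ann_index G2 g2 H2|
       * irr_degree_prod (G2 / H2)%G ^+ #|ann_index G1 g1 H1|))%R.
Proof.
have [z genH1] : exists z, <[z]> = H1.
  have: cyclic H1 by rewrite prime_cyclic ?oH1.
  by case/cyclicP=> z ->; exists z.
have Hz : z \in H1 by rewrite -genH1 cycle_id.
have genH2 : <[theta z]> = H2.
  by case/isomP: iso => _ <-; rewrite -morphim_cycle // genH1.
have oz1 : #[z] = p by rewrite orderE genH1.
have oz2 : #[theta z] = p by rewrite orderE genH2.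
pose N := Group (cprod_ker_group_set theta (abelianS sH1 (center_abelian _))).
have nsN : N <| setX G1 G2.
  exact/sub_center_normal/(cprod_ker_central sH1 sH2 iso).
transitivity
  (\prod_(k : Iirr (setX G1 G2) | N \subset cfker 'chi_k) 'chi_k 1%g)%R.
  rewrite (reindex _ (mod_Iirr_bij nsN)) /=; apply: eq_big => [i | i _].
    by rewrite mod_IirrE ?cfker_mod.
  by rewrite mod_IirrE // cfMod1.
rewrite (reindex _ (onW_bij _ (setX_Iirr_bij G1 G2))) /=.
transitivity
  (\prod_(i : Iirr G1)
     \prod_(j : Iirr G2 | central_value i z == central_value j (theta z))
       ('chi_i 1%g * 'chi_j 1%g))%R.
  rewrite pair_big_dep /=; apply: eq_big => [[i j] | [i j] _] /=.
    exact: (cprod_ker_cfker sH1 sH2 iso).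
  by rewrite -[1]/(1 : gT1, 1 : gT2) setX_IirrE.
under eq_bigr => i _ do rewrite big_split /=.
rewrite big_split /=.
rewrite (prod_degree_pairs p_pr sH1 sH2 genH1 genH2 oz1 oz2 lift_g2).
rewrite (exchange_big_dep xpredT) //=.
under eq_bigr => j _ do under eq_bigl => i do rewrite eq_sym.
rewrite (prod_degree_pairs p_pr sH2 sH1 genH2 genH1 oz2 oz1 lift_g1).
exact: mulrACA.
Qed.

Lemma harada_central_product :
  harada (ext_central_product G1 G2 theta) =
       (p%:R ^+ (#|ann_index G1 g1 H1| * #|ann_index G2 g2 H2|)%N
        * (harada G1 ^+ #|ann_index G2 g2 [1 gT2]|
           * harada G2 ^+ #|ann_index G1 g1 [1 gT1]|)
        * (harada (G1 / H1)%G ^+ #|ann_index G2 g2 H2|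
           * harada (G2 / H2)%G ^+ #|ann_index G1 g1 H1|))%R.
Proof.
rewrite !haradaE irr_degree_prod_central_product.
rewrite (class_card_prod_central_product p_pr sH1 sH2 oH1 oH2 iso lift_g1
           lift_g2).
rewrite !natrM !natrX !exprMn !exprVn !mulf_div.
by rewrite [(p%:R ^+ _ * (_ / _))%R]mulrA mulf_div.
Qed.

End HaradaCentralProduct.

(** The integrality claim does not mention representatives, so it needs some
    choice of them. *)
Lemma class_lift_exists (gT : finGroupType) (G Z : {group gT}) :
  exists g : {set coset_of Z} -> gT, class_lift G g.
Proof.
exists (fun Kb : {set coset_of Z} => repr [set x in G | coset Z x \in Kb]).
move=> Kb.
case/imsetP=> _ /morphimP[x Nx Gx ->] ->.
have: x \in [set y in G | coset Z y \in coset Z x ^: (G / Z)].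
  by rewrite inE Gx class_refl.
by move/mem_repr; rewrite inE => /andP[].
Qed.

Theorem theorem4p11 (gT1 gT2 : finGroupType)
    (G1 H1 : {group gT1}) (G2 H2 : {group gT2}) (p : nat)
    (theta : {morphism H1 >-> gT2}) :
  prime p ->
  H1 \subset 'Z(G1) -> H2 \subset 'Z(G2) ->
  #|H1| = p -> #|H2| = p ->
  isom H1 H2 theta ->
  let G := ext_central_product G1 G2 theta in
  (forall (g1 : {set coset_of H1} -> gT1) (g2 : {set coset_of H2} -> gT2),
     class_lift G1 g1 -> class_lift G2 g2 ->
     harada G =
       (p%:R ^+ (#|ann_index G1 g1 H1| * #|ann_index G2 g2 H2|)%N
        * (harada G1 ^+ #|ann_index G2 g2 [1 gT2]|
           * harada G2 ^+ #|ann_index G1 g1 [1 gT1]|)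
        * (harada (G1 / H1)%G ^+ #|ann_index G2 g2 H2|
           * harada (G2 / H2)%G ^+ #|ann_index G1 g1 H1|))%R)
  /\ (harada G1 \is a Num.int -> harada G2 \is a Num.int ->
      harada (G1 / H1)%G \is a Num.int -> harada (G2 / H2)%G \is a Num.int ->
      harada G \is a Num.int).
Proof.
move=> p_pr sH1 sH2 oH1 oH2 iso G.
split=> [g1 g2 lift1 lift2 | hG1 hG2 hQ1 hQ2].
  exact: harada_central_product.
have [g1 lift1] := class_lift_exists G1 H1.
have [g2 lift2] := class_lift_exists G2 H2.
rewrite (harada_central_product p_pr sH1 sH2 oH1 oH2 iso lift1 lift2).
by rewrite !rpredM ?rpredX ?rpred_nat.
Qed.
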